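(* Let $n\ge1$ and $r\ge0$ be integers and $x=(x_1,\dots,x_n)$, $z$, $q$ indeterminates. Then \begin{multline*} \sum_{\sigma\in \{-1,+1\}^n} \prod_{i=1}^n \frac{1-qx_{i}^{2\sigma_i}} {1-x_{i}^{2\sigma_i}}\, \frac{1-q^rzx_i^{-\sigma_i}} {1-zx_i^{-\sigma_i}}\, \prod_{1\le i < j \le n} \frac {1-qx_{i}^{\sigma_i}x_{j}^{\sigma_j}} {1-x_{i}^{\sigma_i}x_{j}^{\sigma_j}}=\\ q^{nr-\binom{r}{2}}\,(-q;q)_{n-r}\, \frac{(qz^2;q^2)_r}{(qz^2;q)_r}\, {}_{2n+4}{\phi}_{2n+3} \left[\begin{matrix} z^2,qz,-qz,q^{-r},\{qzx_i,qz/x_i\}_{i=1}^n\\ z,-z,q^{r+1}z^2,\{zx_i,z/x_i\}_{i=1}^n \end{matrix};q,-q^{r-n} \right]. \end{multline*}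
   Context: $(a;q)_m=\prod_{l=0}^{m-1}(1-aq^l)$ for $m\ge0$. The symbol $(-q;q)_m$ equals $\prod_{k=1}^m(q^k+1)$ for $m\ge0$ and $\prod_{k=0}^{-m-1}(q^{-k}+1)^{-1}$ for $m<0$. Basic hypergeometric series: ${}_{s+1}\phi_s\left[\begin{matrix}a_1,\dots,a_{s+1}\\ b_1,\dots,b_s\end{matrix};q,y\right]=\sum_{i\ge0}\frac{(a_1;q)_i\cdots(a_{s+1};q)_i}{(b_1;q)_i\cdots(b_s;q)_i}\frac{y^i}{(q;q)_i}$; the notation $\{qzx_i,qz/x_i\}_{i=1}^n$ lists the $2n$ parameters $qzx_1,qz/x_1,\dots,qzx_n,qz/x_n$ (similarly in the denominator). The series terminates because of the parameter $q^{-r}$. *)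

(* Defs.v *)
From mathcomp Require Export all_boot all_algebra mpoly.
From mathcomp Require Export classical_sets fsbigop.

Set Implicit Arguments.
Unset Strict Implicit.
Unset Printing Implicit Defensive.

Import GRing.Theory.
Local Open Scope ring_scope.

Section QSeries.
Variable F : fieldType.
Implicit Types (a q y : F).

Definition qpoch a q (m : nat) : F := \prod_(0 <= l < m) (1 - a * q ^+ l).

(* The symbol (-q;q)_m for an arbitrary integer m; in the second case the
   integer is m = -(p+1), so that -m-1 = p and k runs over 0, ..., p. *)
Definition qpochN q (m : int) : F :=
  match m with
  | Posz p => \prod_(1 <= k < p.+1) (q ^+ k + 1)
  | Negz p => \prod_(0 <= k < p.+1) (q ^- k + 1)^-1
  end.

Definition qhyper_term (s : nat) (a : s.+1.-tuple F) (b : s.-tuple F) q y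
    (i : nat) : F :=
  (\prod_(c <- a) qpoch c q i) / (\prod_(c <- b) qpoch c q i)
  * (y ^+ i / qpoch q q i).

(* The sum over all i >= 0 in the algebraic sense: it has its intended meaning
   when the series terminates, i.e. when only finitely many terms are nonzero
   (and is 0 by convention otherwise). *)
Definition qhyper (s : nat) (a : s.+1.-tuple F) (b : s.-tuple F) q y : F :=
  \sum_(i \in [set: nat]) qhyper_term a b q y i.

Lemma qhyper_terminates (s : nat) (a : s.+1.-tuple F) (b : s.-tuple F) q y
    (r : nat) :
  q != 0 -> q ^- r \in a ->
  qhyper a b q y = \sum_(i < r.+1) qhyper_term a b q y i.
Proof.
move=> q0 ra; rewrite -(big_mkord xpredT (qhyper_term a b q y)).
have ri0 i : (r < i)%N -> qhyper_term a b q y i = 0.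
  move=> ri; rewrite /qhyper_term (big_rem _ ra) /= {1}/qpoch.
  rewrite (bigD1_seq r) ?iota_uniq ?mem_index_iota //= mulVf ?expf_neq0 //.
  by rewrite subrr !mul0r.
rewrite /qhyper -(@fsbig_widen _ _ _ _ [set k | (k < r.+1)%N]) //.
  by rewrite -fsbig_ord big_mkord.
by move=> i [_ /= /negP]; rewrite -leqNgt; exact: ri0.
Qed.

Lemma size_pairs (n : nat) (f g : 'I_n -> F) :
  size (flatten [seq [:: f i; g i] | i <- enum 'I_n]) == (2 * n)%N.
Proof.
rewrite size_flatten /shape -map_comp sumnE big_map /=.
by rewrite big_enum sum_nat_const card_ord mulnC.
Qed.

(* The list f_1, g_1, ..., f_n, g_n. *)
Definition pairs (n : nat) (f g : 'I_n -> F) : (2 * n).-tuple F :=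
  Tuple (size_pairs f g).

End QSeries.

(* The field of rational functions over K in the n + 2 indeterminates
   x_1, ..., x_n, z, q. *)
Definition ratfun (K : fieldType) (n : nat) : fieldType :=
  {fraction {mpoly K[n + 2]}}.

Definition xvar (K : fieldType) (n : nat) (i : 'I_n) : ratfun K n :=
  tofrac ('X_(lshift 2 i) : {mpoly K[n + 2]}).

Definition zvar (K : fieldType) (n : nat) : ratfun K n :=
  tofrac ('X_(rshift n (0 : 'I_2)) : {mpoly K[n + 2]}).

Definition qvar (K : fieldType) (n : nat) : ratfun K n :=
  tofrac ('X_(rshift n (1 : 'I_2)) : {mpoly K[n + 2]}).

(* A sign vector in {-1,+1}^n is encoded as a map to bool, true being -1. *)
Definition sgn_of (n : nat) (s : {ffun 'I_n -> bool}) (i : 'I_n) : int :=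
  (-1) ^+ s i.

(* Main.v *)
(* Writing xi_i = x_i^{s_i}, the product of both sides with
   prod_i (1 - z x_i)(1 - z / x_i) is, in each x_i separately, a Laurent
   polynomial of degree at most 1 that is invariant under x_i -> 1 / x_i.
   Induct on n: fix all variables but u = x_1 and clear denominators, so that
   the difference of the two sides becomes a polynomial of degree at most
   2n + 2 in u. It vanishes at the following 2n + 3 points:
   - u = 0, by the induction hypothesis for (z, r);
   - u = z and u = 1 / z, by the induction hypothesis for (q z, r - 1);
   - u = 1, -1 and u = x_j^{+1}, x_j^{-1} for j > 1, where the apparent poles of
     the sum over signs cancel.
   The case n = 0 is a summable 6phi5; it follows by induction on r from the same
   relations between the coefficients. *)
Require Import Defs.
From mathcomp Require Import all_boot all_algebra mpoly zify ring.

Set Implicit Arguments.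
Unset Strict Implicit.
Unset Printing Implicit Defensive.

Import GRing.Theory.
Local Open Scope ring_scope.

(** * Functions represented by polynomials of bounded degree *)

Section PolyFun.
Variable F : fieldType.
Implicit Types f g : F -> F.

(** Degree at most [m] is stated for functions, so that expressions containing inverses of constants
    need not be rewritten as elements of [{poly F}]. *)
Definition polyfun (m : nat) f : Prop :=
  exists2 p : {poly F}, (size p <= m.+1)%N & forall u, f u = p.[u].

Lemma polyfun_eq m f g : f =1 g -> polyfun m f -> polyfun m g.
Proof. by move=> fg [p sp pE]; exists p => // u; rewrite -fg. Qed.

Lemma polyfun_lin (a b : F) : polyfun 1 (fun u => a + b * u).
Proof.
exists (b%:P * 'X + a%:P); last by move=> u; rewrite !hornerE addrC.
by rewrite size_MXaddC; case: ifP => // _; rewrite ltnS size_polyC; case: eqP.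
Qed.

Lemma polyfunM m m' f g : polyfun m f -> polyfun m' g ->
  polyfun (m + m') (fun u => f u * g u).
Proof.
move=> [p sp pE] [p' sp' pE']; exists (p * p').
  apply: leq_trans (size_polyMleq _ _) _.
  by rewrite -ltnS -addnS -addSn; case: (size p + size p')%N (leq_add sp sp').
by move=> u; rewrite hornerM pE pE'.
Qed.

Lemma polyfunZ m c f : polyfun m f -> polyfun m (fun u => c * f u).
Proof.
move=> [p sp pE]; exists (c *: p); last by move=> u; rewrite hornerZ pE.
exact: leq_trans (size_scale_leq _ _) sp.
Qed.

Lemma polyfunD m f g : polyfun m f -> polyfun m g ->
  polyfun m (fun u => f u + g u).
Proof.
move=> [p sp pE] [p' sp' pE']; exists (p + p').
  by apply: leq_trans (size_polyD _ _) _; rewrite geq_max sp.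
by move=> u; rewrite hornerD pE pE'.
Qed.

Lemma polyfun_sum (I : finType) m (f : I -> F -> F) :
  (forall i, polyfun m (f i)) -> polyfun m (fun u => \sum_i f i u).
Proof.
move=> fP; elim: index_enum => [|i s IHs].
  by exists 0 => [|u]; rewrite ?size_poly0 ?big_nil ?horner0.
by apply: polyfun_eq (polyfunD (fP i) IHs) => u; rewrite big_cons.
Qed.

Lemma polyfun_prod (n m : nat) (f : 'I_n -> F -> F) :
  (forall i, polyfun m (f i)) -> polyfun (n * m) (fun u => \prod_i f i u).
Proof.
elim: n f => [|n IHn] f fP.
  by exists 1 => [|u]; rewrite ?size_poly1 ?big_ord0 ?hornerC.
rewrite mulSn; apply: polyfun_eq (polyfunM (fP ord0) (IHn _ (fun i => fP _))) => u.
by rewrite big_ord_recl.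
Qed.

Lemma polyfun_eq0 m f (rs : seq F) : polyfun m f -> uniq rs ->
  (m < size rs)%N -> {in rs, forall u, f u = 0} -> forall u, f u = 0.
Proof.
move=> [p sp pE] urs mrs f0 u; rewrite pE.
suff -> : p = 0 by rewrite horner0.
apply/eqP; case: eqP => // /eqP p0; have := @max_poly_roots _ p rs p0.
rewrite urs => /(_ _ isT) H.
have /H : all (root p) rs by apply/allP => a /f0 fa; rewrite /root -pE fa.
by rewrite ltnNge (leq_trans sp).
Qed.
End PolyFun.

(** * Products over pairs of indices *)

Section Pairs.
Variables (R : comPzRingType) (n : nat).

(** Separates the factors that involve the index [k]; symmetry of [g] turns those with [i < k] into
    the form [g k i]. *)
Lemma prod_pairsD1 (g : 'I_n -> 'I_n -> R) (k : 'I_n) :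
  (forall i j, g i j = g j i) ->
  \prod_(i < n) \prod_(j < n | (i < j)%N) g i j =
  (\prod_(i | i != k) g k i) *
  \prod_(i < n | i != k) \prod_(j < n | (i < j)%N && (j != k)) g i j.
Proof.
move=> gC; rewrite (bigD1 k) //=.
under [X in _ * X = _]eq_bigr => i ik.
  rewrite (bigID (fun j => j == k)) /=; over.
rewrite big_split /= mulrA; congr (_ * _).
rewrite [RHS](bigID (fun i : 'I_n => (k < i)%N)) /=; congr (_ * _).
  by apply: eq_bigl => j; rewrite -val_eqE /=; case: ltngtP.
rewrite [RHS]big_mkcondr /=; apply: eq_bigr => i ik.
rewrite big_mkcondl big_pred1_eq gC.
by move: ik; rewrite -val_eqE /=; case: ltngtP.
Qed.
End Pairs.

(** * Coefficients of the series and the relations between them *)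

Section Coefficients.
Variables (F : fieldType) (q : F).
Hypotheses (q0 : q != 0) (qn1 : forall k, q ^+ k.+1 != 1).

Lemma qpochS (a : F) (b : F) m : qpoch a b m.+1 = qpoch a b m * (1 - a * b ^+ m).
Proof. by rewrite /qpoch big_nat_recr. Qed.

Lemma qpochSl (a : F) (b : F) m :
  qpoch a b m.+1 = (1 - a) * qpoch (a * b) b m.
Proof.
rewrite /qpoch big_nat_recl // mulr1; congr (_ * _).
by apply: eq_bigr => i _; rewrite exprS mulrA.
Qed.

Lemma exprVSK k : q ^- k.+1 * q = q ^- k.
Proof. by rewrite exprSr invfM mulfVK. Qed.

Lemma qpoch_neq0 (a b : F) m :
  (forall k, (k < m)%N -> a * b ^+ k != 1) -> qpoch a b m != 0.
Proof.
move=> H; rewrite /qpoch; elim: m H => [|m IHm] H; first by rewrite big_geq ?oner_eq0.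
rewrite big_nat_recr //= mulf_neq0 ?IHm //; last by rewrite subr_eq0 eq_sym H.
by move=> k km; apply: H; rewrite ltnW.
Qed.

Lemma qaddr1_neq0 k : q ^+ k.+1 + 1 != 0.
Proof.
apply/negP => /eqP H; have := qn1 (k + k.+1); rewrite -addSn exprD.
by rewrite (_ : q ^+ k.+1 = -1) ?mulrNN ?mulr1 ?eqxx //; apply/eqP; rewrite -addr_eq0 H.
Qed.

Hypothesis two_neq0 : 2 != 0 :> F.

(** One recurrence covers both branches of [qpochN]. At m = -1 the factor is q^0 + 1 = 2, whence the
    condition on the characteristic. *)
Lemma qpochNS (m : int) : qpochN q (m + 1) = qpochN q m * (q ^ (m + 1) + 1).
Proof.
case: m => [m|m].
  by rewrite -PoszD addn1 /qpochN big_nat_recr.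
have nz : q ^- m + 1 != 0.
  case: m => [|m]; first by rewrite invr1.
  have -> : q ^- m.+1 + 1 = (q ^+ m.+1 + 1) / q ^+ m.+1.
    by rewrite mulrDl divff ?expf_neq0 // mul1r addrC.
  by rewrite mulf_neq0 ?invr_eq0 ?expf_neq0 ?qaddr1_neq0.
have -> : Negz m + 1 = - m%:Z by rewrite NegzE -addn1 PoszD opprD addrNK.
rewrite [qpochN q (Negz m)]/= big_nat_recr //= -exprnN mulfVK //.
case: m nz => [|m] nz; first by rewrite oppr0 /= !big_geq.
by rewrite -NegzE.
Qed.

Definition prefactor (z : F) (n r : nat) : F :=
  q ^ ((n * r)%:Z - 'C(r, 2)%:Z) * qpochN q (n%:Z - r%:Z)
  * (qpoch (q * z ^+ 2) (q ^+ 2) r / qpoch (q * z ^+ 2) q r).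

(** The part of the i-th term of the right-hand side that is free of x. The parameters qz, -qz over
    z, -z have been collapsed into the quotient of 1 - z^2 q^(2i) by 1 - z^2. *)
Definition coef (z : F) (n r i : nat) : F :=
  prefactor z n r *
  (qpoch (z ^+ 2) q i * qpoch (q ^- r) q i
   / (qpoch q q i * qpoch (q ^+ r.+1 * z ^+ 2) q i)
   * ((1 - z ^+ 2 * q ^+ i ^+ 2) / (1 - z ^+ 2))
   * (- q ^ (r%:Z - n%:Z)) ^+ i).

Lemma coef_gt z n r i : (r < i)%N -> coef z n r i = 0.
Proof.
move=> ri; rewrite /coef {2}/qpoch.
by rewrite (bigD1_seq r) ?iota_uniq ?mem_index_iota //= mulVf ?expf_neq0 // subrr
  mul0r mulr0 !mul0r mulr0.
Qed.

(** The factor is q^r (q^(n+1-r) + 1): the power of q supplies q^r, and [qpochNS] supplies the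
    rest. *)
Lemma prefactorS z n r :
  prefactor z n.+1 r = (q ^+ r + q ^+ n.+1) * prefactor z n r.
Proof.
rewrite /prefactor.
have -> : n.+1%:Z - r%:Z = n%:Z - r%:Z + 1 by rewrite -addn1 PoszD addrAC.
rewrite qpochNS mulSn PoszD -addrA [q ^ (r%:Z + _)]expfzDr // -exprnP.
have -> : q ^+ r + q ^+ n.+1 = q ^+ r * (q ^ (n%:Z - r%:Z + 1) + 1).
  rewrite mulrDr mulr1 addrC -[q ^+ r]/(q ^ r%:Z) -[q ^+ n.+1]/(q ^ n.+1%:Z).
  rewrite -expfzDr //; congr (_ ^ _ + _).
  by rewrite addrA [r%:Z + _]addrC subrK -PoszD addn1.
by ring.
Qed.

(** This is the comparison of coefficients at u = 0. Raising [n] divides the argument of the series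
    by q, which [q ^+ i] compensates. *)
Lemma coefSl z n r i :
  coef z n.+1 r i * q ^+ i = (q ^+ r + q ^+ n.+1) * coef z n r i.
Proof.
rewrite /coef prefactorS.
have -> : (- q ^ (r%:Z - n%:Z)) ^+ i = (- q ^ (r%:Z - n.+1%:Z)) ^+ i * q ^+ i.
  rewrite -exprMn mulNr -[X in _ = (- (_ * X)) ^+ _]expr1z -expfzDr //.
  by congr ((- (_ ^ _)) ^+ _); rewrite -[n.+1]addn1 PoszD opprD addrA subrK.
by ring.
Qed.

Variable z : F.
Hypothesis z2 : forall k, z ^+ 2 * q ^+ k != 1.

Lemma z2_neq0 k : 1 - z ^+ 2 * q ^+ k != 0.
Proof. by rewrite subr_eq0 eq_sym. Qed.

(** This is the comparison of coefficients at u = z. Lowering [n] and [r] together keeps r - n,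
    hence the argument of the series, while z becomes qz and the index shifts by one. *)
Lemma coefSS n r i :
  coef z n.+1 r.+1 i.+1 * ((1 - z ^+ 2 * q ^+ i.+1) * (1 - q ^+ i.+1)) =
  (1 - q ^+ r.+1) * (1 - q * z ^+ 2) * coef (q * z) n r i.
Proof.
have E1 : q ^ ((n.+1 * r.+1)%:Z - 'C(r.+1, 2)%:Z) =
    q ^+ n.+1 * q ^ ((n * r)%:Z - 'C(r, 2)%:Z).
  rewrite -[q ^+ n.+1]/(q ^ n.+1%:Z) -expfzDr //; congr (_ ^ _).
  by rewrite binS bin1 mulSn mulnS; lia.
have E2 : n.+1%:Z - r.+1%:Z = n%:Z - r%:Z by lia.
have E3 : r.+1%:Z - n.+1%:Z = r%:Z - n%:Z by lia.
have E4 : q ^ (r%:Z - n%:Z) = q ^+ r / q ^+ n by rewrite expfzDr // -exprnN.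
rewrite /coef /prefactor E1 E2 E3 E4.
set P := q ^ (_ - _); set Q := qpochN _ _.
have e5 : qpoch (q * z ^+ 2) (q ^+ 2) r.+1 =
    (1 - q * z ^+ 2) * qpoch (q * (q * z) ^+ 2) (q ^+ 2) r.
  by rewrite qpochSl; congr (_ * qpoch _ _ _); ring.
(* The factor 1 - z^2 q^(r+2) is inserted to cancel the one that comes out of [e10]. *)
have e6 : qpoch (q * z ^+ 2) q r.+1 * (1 - z ^+ 2 * q ^+ r.+2) =
   (1 - q * z ^+ 2) * (1 - q ^+ 2 * z ^+ 2) * qpoch (q * (q * z) ^+ 2) q r.
  have -> : 1 - z ^+ 2 * q ^+ r.+2 = 1 - q * z ^+ 2 * q ^+ r.+1 by rewrite !exprS; ring.
  rewrite -qpochS qpochSl -[RHS]mulrA; congr (_ * _).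
  rewrite qpochSl; congr (_ * _); first by ring.
  by congr qpoch; ring.
have e7 : qpoch (z ^+ 2) q i.+1 * (1 - z ^+ 2 * q ^+ i.+1) =
   (1 - z ^+ 2) * (1 - q * z ^+ 2) * qpoch ((q * z) ^+ 2) q i.
  rewrite -qpochS qpochSl -[RHS]mulrA; congr (_ * _).
  rewrite qpochSl [z ^+ 2 * q]mulrC; congr (_ * _).
  by congr qpoch; ring.
have e8 : qpoch (q ^- r.+1) q i.+1 = (1 - q ^- r.+1) * qpoch (q ^- r) q i.
  by rewrite qpochSl exprVSK.
have e9 : qpoch q q i.+1 = qpoch q q i * (1 - q ^+ i.+1) by rewrite qpochS exprS.
have e10 : qpoch (q ^+ r.+2 * z ^+ 2) q i.+1 =
   (1 - z ^+ 2 * q ^+ r.+2) * qpoch (q ^+ r.+1 * (q * z) ^+ 2) q i.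
  rewrite qpochSl [z ^+ 2 * _]mulrC; congr (_ * _).
  by congr qpoch; rewrite !exprS; ring.
have n5 : qpoch (q * (q * z) ^+ 2) q r != 0.
  apply: qpoch_neq0 => k _; apply: contraNneq (z2 k.+3) => /= <-.
  by apply/eqP; rewrite !exprS; ring.
have n9 : qpoch q q i != 0 by apply: qpoch_neq0 => k _; rewrite -exprS.
have n10 : qpoch (q ^+ r.+1 * (q * z) ^+ 2) q i != 0.
  apply: qpoch_neq0 => k _; apply: contraNneq (z2 (r.+3 + k)) => /= <-.
  by apply/eqP; rewrite !exprS !exprD; ring.
have n7 : 1 - z ^+ 2 * q ^+ i.+1 != 0 := z2_neq0 _.
have n8 : 1 - z ^+ 2 * q ^+ r.+2 != 0 := z2_neq0 _.
have n11 : 1 - z ^+ 2 != 0 by have := z2_neq0 0; rewrite mulr1.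
have n12 : 1 - q * z ^+ 2 != 0 by have := z2_neq0 1; rewrite mulrC.
have n13 : 1 - q ^+ 2 * z ^+ 2 != 0 by have := z2_neq0 2; rewrite mulrC.
have n14 : 1 - q ^+ i.+1 != 0 by rewrite subr_eq0 eq_sym.
have e6' : qpoch (q * z ^+ 2) q r.+1 = (1 - q * z ^+ 2) * (1 - q ^+ 2 * z ^+ 2)
    * qpoch (q * (q * z) ^+ 2) q r / (1 - z ^+ 2 * q ^+ r.+2).
  by rewrite -e6 mulfK.
have e7' : qpoch (z ^+ 2) q i.+1 = (1 - z ^+ 2) * (1 - q * z ^+ 2)
    * qpoch ((q * z) ^+ 2) q i / (1 - z ^+ 2 * q ^+ i.+1).
  by rewrite -e7 mulfK.
have e11 : (q * z) ^+ 2 * q ^+ i ^+ 2 = z ^+ 2 * q ^+ i.+1 ^+ 2.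
  by rewrite [q ^+ i.+1]exprS; ring.
have e12 : 1 - (q * z) ^+ 2 = 1 - q ^+ 2 * z ^+ 2 by ring.
(* The power q^(n+1) from [E1], the extra factor -q^(r-n) and the factor 1 - q^(-r-1) from [e8]
   multiply to 1 - q^(r+1). *)
rewrite e5 e6' e7' e8 e9 e10 e11 e12 [(- _) ^+ i.+1]exprS.
set M := (- _) ^+ i.
move: n5 n9 n10 n7 n8 n11 n12 n13 n14 (expf_neq0 r q0) (expf_neq0 n q0).
move: (qpoch _ (q ^+ 2) r) (qpoch _ q r)
 (qpoch q q i) (qpoch (q ^+ r.+1 * (q * z) ^+ 2) q i) => X1 X2 X3 X4.
move: (qpoch ((q * z) ^+ 2) q i) (qpoch (q ^- r) q i) => X5 X6.
rewrite [q ^+ i.+1]exprS [q ^+ r.+2]exprS [q ^+ r.+1]exprS [q ^+ n.+1]exprS.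
move: (q ^+ r) (q ^+ n) (q ^+ i) P Q M => X7 X8 X9 X10 X11 X12.
by move=> *; field; rewrite e12; do ?[apply/andP; split].
Qed.

(** As in [coefSS], the difference r - n is preserved, but here z and the index stay fixed:
    (q^(-r-1);q)_i is compared with (q^(-r);q)_i. *)
Lemma coef1S r i :
  coef z 1 r.+1 i * ((1 - q ^- r.+1 * q ^+ i) * (1 - z ^+ 2 * q ^+ (r.+1 + i))) =
  q * (1 - z ^+ 2 * q ^+ (2 * r).+1) * (1 - q ^- r.+1) * coef z 0 r i.
Proof.
have E1 : q ^ ((1 * r.+1)%:Z - 'C(r.+1, 2)%:Z) =
    q * q ^ ((0 * r)%:Z - 'C(r, 2)%:Z).
  rewrite -[X in X * _]expr1z -expfzDr //; congr (_ ^ _).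
  by rewrite binS bin1 mul1n mul0n; lia.
have E2 : 1%:Z - r.+1%:Z = 0%:Z - r%:Z by lia.
have E3 : r.+1%:Z - 1%:Z = r%:Z - 0%:Z by lia.
rewrite /coef /prefactor E1 E2 E3.
set P := q ^ (_ - _); set Q := qpochN _ _.
have e5 : qpoch (q * z ^+ 2) (q ^+ 2) r.+1 =
    qpoch (q * z ^+ 2) (q ^+ 2) r * (1 - z ^+ 2 * q ^+ (2 * r).+1).
  by rewrite qpochS [q ^+ (2 * r).+1]exprS exprM; congr (_ * (1 - _)); ring.
have e6 : qpoch (q * z ^+ 2) q r.+1 =
    qpoch (q * z ^+ 2) q r * (1 - z ^+ 2 * q ^+ r.+1).
  by rewrite qpochS [q ^+ r.+1]exprS; congr (_ * (1 - _)); ring.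
have e8 : qpoch (q ^- r.+1) q i * (1 - q ^- r.+1 * q ^+ i) =
    (1 - q ^- r.+1) * qpoch (q ^- r) q i.
  by rewrite -qpochS qpochSl exprVSK.
have e10 : (1 - z ^+ 2 * q ^+ r.+1) * qpoch (q ^+ r.+2 * z ^+ 2) q i =
   qpoch (q ^+ r.+1 * z ^+ 2) q i * (1 - z ^+ 2 * q ^+ (r.+1 + i)).
  have -> : z ^+ 2 * q ^+ (r.+1 + i) = q ^+ r.+1 * z ^+ 2 * q ^+ i.
    by rewrite exprD; ring.
  rewrite -qpochS qpochSl [z ^+ 2 * _]mulrC; congr (_ * qpoch _ _ _).
  by rewrite !exprS; ring.
have n6 : qpoch (q * z ^+ 2) q r != 0.
  apply: qpoch_neq0 => k _; apply: contraNneq (z2 k.+1) => /= <-.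
  by apply/eqP; rewrite !exprS; ring.
have n9 : qpoch q q i != 0 by apply: qpoch_neq0 => k _; rewrite -exprS.
have n10 : qpoch (q ^+ r.+1 * z ^+ 2) q i != 0.
  apply: qpoch_neq0 => k _; apply: contraNneq (z2 (r.+1 + k)) => /= <-.
  by apply/eqP; rewrite !exprD; ring.
have n7 : 1 - z ^+ 2 * q ^+ (r.+1 + i) != 0 := z2_neq0 _.
have n8 : 1 - z ^+ 2 * q ^+ r.+1 != 0 := z2_neq0 _.
have n11 : 1 - z ^+ 2 != 0 by have := z2_neq0 0; rewrite mulr1.
have e10' : qpoch (q ^+ r.+2 * z ^+ 2) q i =
   qpoch (q ^+ r.+1 * z ^+ 2) q i * (1 - z ^+ 2 * q ^+ (r.+1 + i))
   / (1 - z ^+ 2 * q ^+ r.+1).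
  by rewrite -e10 [RHS]mulrAC mulfV ?mul1r.
rewrite e5 e6 e10'.
move: (e8) n6 n9 n10 n7 n8 n11.
move: (qpoch (q ^- r.+1) q i) (1 - q ^- r.+1 * q ^+ i) (1 - q ^- r.+1)
 (qpoch (q ^- r) q i) => Y1 Y2 Y3 Y4 Y.
move: (1 - z ^+ 2 * q ^+ (2 * r).+1) (1 - z ^+ 2 * q ^+ r.+1)
 (1 - z ^+ 2 * q ^+ (r.+1 + i)) (1 - z ^+ 2 * q ^+ i ^+ 2) (1 - z ^+ 2)
 (qpoch (q * z ^+ 2) (q ^+ 2) r) (qpoch (q * z ^+ 2) q r) (qpoch (z ^+ 2) q i)
 (qpoch q q i) (qpoch (q ^+ r.+1 * z ^+ 2) q i) ((- _) ^+ i) P Q.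
move=> X1 X2 X3 X4 X5 X6 X7 X8 X9 X10 X11 P' Q' *.
transitivity (q * P' * Q' * (X6 * X1 / (X7 * X2))
  * (X8 / (X9 * (X10 * X3 / X2)) * (X4 / X5) * X11) * X3 * (Y1 * Y2)).
  by ring.
by rewrite Y; field; do ?[apply/andP; split].
Qed.

End Coefficients.

(* The identity [key] expresses the summand for [r.+1] through summands for [r],
   at [z] (via [coef1S]) and at [q * z] (via [coefSS]). *)
Lemma sum_coef0 (F : fieldType) (q : F) (q0 : q != 0)
   (qn1 : forall k, q ^+ k.+1 != 1) (two_neq0 : 2 != 0 :> F) (r : nat) (z : F) :
  (forall k, z ^+ 2 * q ^+ k != 1) -> \sum_(i < r.+1) coef q z 0 r i = 1.
Proof.
elim: r z => [|r IHr] z z2.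
  rewrite big_ord1 /coef /prefactor /qpoch.
  have -> : (0 * 0)%:Z - 'C(0, 2)%:Z = 0 by [].
  rewrite ?subrr expr0z [qpochN _ _]/= !big_geq // !expr0 expr1n mulr1.
  have nz : 1 - z ^+ 2 != 0 by have := z2_neq0 z2 0; rewrite mulr1.
  by rewrite (divff nz) ?(mulr1, invr1).
have zq2 k : (q * z) ^+ 2 * q ^+ k != 1.
  apply: contraNneq (z2 k.+2) => /= <-; apply/eqP; rewrite !exprS; ring.
have key (i : nat) : (1 - q ^- r.+1) * (1 - z ^+ 2 * q ^+ r.+1) * q ^+ i =
    (1 - q ^- r.+1 * q ^+ i) * (1 - z ^+ 2 * q ^+ (r.+1 + i))
    - (1 - z ^+ 2 * q ^+ i) * (1 - q ^+ i).
  by rewrite exprD; field; rewrite expf_neq0.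
have nz1 : 1 - q ^- r.+1 != 0.
  by rewrite subr_eq0 eq_sym invr_eq1.
have nz2 := z2_neq0 z2 r.+1.
(* This is the factor of [coefSl] for n = 0 and r + 1; it equals 2q when r = 0. *)
have nz3 : q ^+ r.+1 + q ^+ 1 != 0.
  case: r {IHr key nz1 nz2} => [|r]; first by rewrite -mulr2n -mulr_natl mulf_neq0 ?expr1.
  by rewrite exprS expr1 -[X in _ + X]mulr1 -mulrDr mulf_neq0 ?qaddr1_neq0.
have S1 : \sum_(i < r.+2)
   coef q z 1 r.+1 i * ((1 - q ^- r.+1 * q ^+ i) * (1 - z ^+ 2 * q ^+ (r.+1 + i)))
   = q * (1 - z ^+ 2 * q ^+ (2 * r).+1) * (1 - q ^- r.+1).
  (* The sum has one index more than the induction hypothesis; the additional coefficient vanishes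
     by [coef_gt]. *)
  under eq_bigr => i _ do rewrite coef1S //.
  by rewrite -mulr_sumr big_ord_recr /= coef_gt // addr0 IHr // mulr1.
have S2 : \sum_(i < r.+2)
   coef q z 1 r.+1 i * ((1 - z ^+ 2 * q ^+ i) * (1 - q ^+ i))
   = (1 - q ^+ r.+1) * (1 - q * z ^+ 2).
  rewrite big_ord_recl subrr !mulr0 add0r.
  under eq_bigr => i _ do rewrite coefSS //.
  by rewrite -mulr_sumr IHr // mulr1.
have nz : (1 - q ^- r.+1) * (1 - z ^+ 2 * q ^+ r.+1) * (q ^+ r.+1 + q ^+ 1) != 0.
  by rewrite !mulf_neq0.
(* With the factor of [coefSl] the coefficients for n = 0 become those for n = 1 times q^i, and
   [key] then splits that q^i. *)
apply: (mulfI nz); rewrite mulr1 mulr_sumr.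
transitivity (\sum_(i < r.+2)
  (coef q z 1 r.+1 i * ((1 - q ^- r.+1 * q ^+ i) * (1 - z ^+ 2 * q ^+ (r.+1 + i)))
   - coef q z 1 r.+1 i * ((1 - z ^+ 2 * q ^+ i) * (1 - q ^+ i)))).
  apply: eq_bigr => i _; rewrite -mulrBr -key [RHS]mulrCA (coefSl q0 qn1 two_neq0).
  exact: esym (mulrA _ _ _).
rewrite sumrB S1 S2 mul2n -addnn -addSn exprD [q ^+ r.+1]exprS.
by field; rewrite expf_neq0.
Qed.

(** Groups the sign vectors that differ only at index 0, so that the weights at u and 1/u can be
    added before denominators are cleared. *)
Lemma sum_ffun_bool_recl (V : nmodType) n (f : {ffun 'I_n.+1 -> bool} -> V) :
  let consf b (s : {ffun 'I_n -> bool}) :=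
    [ffun i => oapp s b (unlift ord0 i)] in
  \sum_s f s = \sum_s (f (consf false s) + f (consf true s)).
Proof.
move=> consf; rewrite (reindex (fun p => consf p.1 p.2)) /=; last first.
  exists (fun s => (s ord0, [ffun i => s (lift ord0 i)])) => [[b s] _|s _] /=.
    congr pair; first by rewrite ffunE unlift_none.
    by apply/ffunP => i; rewrite !ffunE liftK.
  by apply/ffunP => i; rewrite ffunE; case: unliftP => [j|] -> /=; rewrite ?ffunE.
rewrite -(pair_bigA _ (fun b s => f (consf b s))) /= exchange_big /=.
by apply: eq_bigr => s _; rewrite big_bool addrC.
Qed.

(** * The summands of the sum over signs and their numerators in one variable *)

Section SignSum.
Variables (F : fieldType) (q : F).

Definition pairw (a b : F) := (1 - q * a * b) / (1 - a * b).

(** Here [v] stands for q^r z. It is a separate parameter because passing from (z, r) to (qz, r - 1)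
    leaves it fixed. *)
Definition singlew (z v a : F) :=
  (1 - q * a ^+ 2) / (1 - a ^+ 2) * ((1 - v / a) / (1 - z / a)).

Definition weight n (z v : F) (xi : 'I_n -> F) :=
  (\prod_(i < n) singlew z v (xi i))
  * \prod_(i < n) \prod_(j < n | (i < j)%N) pairw (xi i) (xi j).

Definition signed n (x : 'I_n -> F) (s : {ffun 'I_n -> bool}) (i : 'I_n) :=
  if s i then (x i)^-1 else x i.

Definition zfactor n (z : F) (x : 'I_n -> F) :=
  \prod_(i < n) ((1 - z * x i) * (1 - z / x i)).

(* What remains of [weight] at [u, xi] plus [weight] at [u^-1, xi] once
   [weight] at [xi] and all the denominators have been cleared. *)
Definition numer n (z v : F) (xi : 'I_n -> F) (u : F) :=
  (1 - q * u ^+ 2) * (u - v) * (1 - z * u)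
    * \prod_(i < n) ((1 - q * xi i * u) * (1 - u / xi i))
  + (q - u ^+ 2) * (1 - v * u) * (u - z)
    * \prod_(i < n) ((q - u / xi i) * (1 - xi i * u)).

Definition consfun n (a : F) (xi : 'I_n -> F) (i : 'I_n.+1) :=
  oapp xi a (unlift ord0 i).

Lemma eq_weight n z v (xi xi' : 'I_n -> F) :
  xi =1 xi' -> weight z v xi = weight z v xi'.
Proof.
move=> E; rewrite /weight; congr (_ * _); first by apply: eq_bigr => i _; rewrite E.
by apply: eq_bigr => i _; apply: eq_bigr => j _; rewrite !E.
Qed.

Lemma weight_cons n z v a (xi : 'I_n -> F) :
  weight z v (consfun a xi) =
  singlew z v a * \prod_(i < n) pairw a (xi i) * weight z v xi.
Proof.
have E0 : consfun a xi ord0 = a by rewrite /consfun unlift_none.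
have Ei i : consfun a xi (lift ord0 i) = xi i by rewrite /consfun liftK.
rewrite /weight !big_ord_recl E0.
under eq_bigr => i _ do rewrite Ei.
have -> : \prod_(j < n.+1 | ((ord0 : 'I_n.+1) < j)%N) pairw a (consfun a xi j)
   = \prod_(i < n) pairw a (xi i).
  rewrite [LHS]big_mkcond [LHS]big_ord_recl /= mul1r.
  by apply: eq_bigr => i _; rewrite Ei.
have -> : \prod_(i < n) \prod_(j < n.+1 | (lift ord0 i < j)%N)
      pairw (consfun a xi (lift ord0 i)) (consfun a xi j)
   = \prod_(i < n) \prod_(j < n | (i < j)%N) pairw (xi i) (xi j).
  apply: eq_bigr => i _; rewrite big_mkcond big_ord_recl /= mul1r [RHS]big_mkcond.
  by apply: eq_bigr => j _; rewrite !Ei.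
exact: mulrACA.
Qed.

Lemma zfactor_cons n z a (x : 'I_n -> F) :
  zfactor z (consfun a x) = (1 - z * a) * (1 - z / a) * zfactor z x.
Proof.
rewrite /zfactor big_ord_recl /consfun unlift_none /=; congr (_ * _).
by apply: eq_bigr => i _; rewrite liftK.
Qed.

Lemma zfactor_signed n u (x : 'I_n -> F) s : zfactor u (signed x s) = zfactor u x.
Proof.
apply: eq_bigr => i _; rewrite /signed; case: (s i) => //.
by rewrite invrK mulrC.
Qed.

(** The factors of [zfactor u xi] are, up to units, the denominators of both [pairw u (xi i)] and
    [pairw u^-1 (xi i)], so one factor clears the two weights. *)
Lemma weight_numer n z v u (xi : 'I_n -> F) :
  u != 0 -> 1 - u ^+ 2 != 0 -> 1 - z * u != 0 -> u - z != 0 ->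
  (forall i, xi i != 0) -> (forall i, 1 - u * xi i != 0) ->
  (forall i, u - xi i != 0) ->
  u * (1 - u ^+ 2) * zfactor u xi * ((1 - z * u) * (1 - z / u)) *
  (weight z v (consfun u xi) + weight z v (consfun u^-1 xi)) =
  weight z v xi * numer z v xi u.
Proof.
move=> u0 u2 uz zu xi0 uxi uxi'; rewrite !weight_cons /numer.
have -> : \prod_(i < n) ((1 - q * xi i * u) * (1 - u / xi i)) =
    \prod_(i < n) pairw u (xi i) * zfactor u xi.
  rewrite -big_split; apply: eq_bigr => i _ /=; rewrite /pairw.
  by have := uxi i; have := xi0 i; move: (xi i) => y *; field; apply/andP.
have -> : \prod_(i < n) ((q - u / xi i) * (1 - xi i * u)) =
    \prod_(i < n) pairw u^-1 (xi i) * zfactor u xi.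
  rewrite -big_split; apply: eq_bigr => i _ /=; rewrite /pairw.
  have := uxi i; have := xi0 i; have := uxi' i; move: (xi i) => y *; field.
  by do ?[apply/andP; split].
rewrite /singlew; move: (\prod_(i < n) _) (\prod_(i < n) _) (zfactor _ _) => P1 P2 Z.
move: (weight _ _ _) => W.
have u2' : u ^+ 2 - 1 != 0 by rewrite -oppr_eq0 opprB.
by field; do ?[apply/andP; split]; rewrite ?oner_eq0.
Qed.

(** Inverting [u] exchanges the two summands of [numer]; the sign comes from 1 - q/u^2 = -(q -
    u^2)/u^2. *)
Lemma numer_inv n z v (xi : 'I_n -> F) u : u != 0 -> (forall i, xi i != 0) ->
  numer z v xi u^-1 =
  - ((u ^- 2) ^+ 2 * \prod_(i < n) u ^- 2) * numer z v xi u.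
Proof.
move=> u0 xi0; rewrite /numer.
have -> : \prod_(i < n) ((1 - q * xi i / u) * (1 - u^-1 / xi i)) =
   \prod_(i < n) u ^- 2 * \prod_(i < n) ((q - u / xi i) * (1 - xi i * u)).
  rewrite -big_split; apply: eq_bigr => i _ /=.
  by have := xi0 i; move: (xi i) => y *; field; apply/andP.
have -> : \prod_(i < n) ((q - u^-1 / xi i) * (1 - xi i / u)) =
   \prod_(i < n) u ^- 2 * \prod_(i < n) ((1 - q * xi i * u) * (1 - u / xi i)).
  rewrite -big_split; apply: eq_bigr => i _ /=.
  by have := xi0 i; move: (xi i) => y *; field; apply/andP.
move: (\prod_(i < n) _) (\prod_(i < n) _) (\prod_(i < n) _) => P1 P2 P3.
by field.
Qed.

(** The apparent pole at u = c cancels between two sign vectors differing only at [k]: each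
    numerator keeps one summand, and these two contributions are opposite. *)
Lemma weight_numer_flip n z v (xi xi' : 'I_n -> F) (k : 'I_n) c :
  c != 0 -> 1 - c ^+ 2 != 0 -> 1 - z * c != 0 -> c - z != 0 ->
  xi k = c -> xi' k = c^-1 ->
  (forall i, i != k -> xi i = xi' i) ->
  (forall i, i != k -> xi i != 0) ->
  (forall i, i != k -> 1 - c * xi i != 0) ->
  (forall i, i != k -> c - xi i != 0) ->
  weight z v xi * numer z v xi c + weight z v xi' * numer z v xi' c = 0.
Proof.
move=> c0 c2 cz zc xik xik' xiE xi0 cxi cxi'.
have pC a b : pairw a b = pairw b a by rewrite /pairw mulrAC [a * b]mulrC.
rewrite /weight !(prod_pairsD1 k (fun i j => pC (_ i) (_ j))).
set R := \prod_(i < n | _) \prod_(j < n | _) pairw (xi i) (xi j).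
have -> : \prod_(i < n | i != k) \prod_(j < n | (i < j)%N && (j != k))
    pairw (xi' i) (xi' j) = R.
  by apply: eq_bigr => i ik; apply: eq_bigr => j /andP[_ jk]; rewrite !xiE.
rewrite (bigD1 k) //= [\prod_i singlew _ _ (xi' i)](bigD1 k) //= xik xik'.
set S := \prod_(i < n | i != k) singlew z v (xi i).
have -> : \prod_(i < n | i != k) singlew z v (xi' i) = S.
  by apply: eq_bigr => i ik; rewrite xiE.
rewrite /numer.
(* The factor at [k] kills the first product for [xi] and the second one for [xi']. *)
rewrite [\prod_i (_ * (1 - c / xi i))](bigD1 k) //= xik divff // subrr mulr0 mul0r.
rewrite [\prod_i (_ * (1 - xi' i * c))](bigD1 k) //= xik' mulVf // subrr !(mulr0, mul0r).
rewrite add0r addr0.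
rewrite [\prod_i (_ * (1 - xi i * c))](bigD1 k) //= xik.
rewrite [\prod_i (_ * (1 - c / xi' i))](bigD1 k) //= xik'.
set P := \prod_(i | _) pairw c (xi i).
set P' := \prod_(i | _) pairw c^-1 (xi' i).
set B := \prod_(i < n | _) (_ * (1 - xi i * c)).
set A := \prod_(i < n | _) (_ * (1 - c / xi' i)).
(* The indices other than [k] contribute equally to both terms, which leaves an identity in [c],
   [z], [v] and [q] alone. *)
have E : P * B = P' * A.
  rewrite /P /P' /A /B -!big_split; apply: eq_bigr => i ik /=.
  rewrite -xiE // /pairw; have := cxi i ik; have := xi0 i ik; have := cxi' i ik.
  by move: (xi i) => y *; field; do ?[apply/andP; split]; rewrite ?oner_eq0.
transitivity (R * S * (P * B) * (singlew z v c * ((q - c ^+ 2) * (1 - v * c)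
   * (c - z) * ((q - 1) * (1 - c * c)))) + R * S * (P' * A) * (singlew z v c^-1
   * ((1 - q * c ^+ 2) * (c - v) * (1 - z * c) * ((1 - q / c * c) * (1 - c / c^-1))))).
  by rewrite divff //; ring.
rewrite E /singlew; move: (P' * A) => {}A {E}; move: R S => R S.
have c2' : c ^+ 2 - 1 != 0 by rewrite -oppr_eq0 opprB.
by field; do ?[apply/andP; split]; rewrite ?oner_eq0.
Qed.

Lemma polyfun_numer n z v (xi : 'I_n -> F) :
  polyfun (4 + n * 2) (numer z v xi).
Proof.
have sq (a b : F) : polyfun 2 (fun u => a + b * u ^+ 2).
  exists (b *: 'X^2 + a%:P); last by move=> u; rewrite !hornerE addrC.
  apply: leq_trans (size_polyD _ _) _; rewrite geq_max.
  rewrite (leq_trans (size_scale_leq _ _)) ?size_polyXn //.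
  by rewrite size_polyC; case: eqP.
have lin := @polyfun_lin F.
rewrite /numer; apply: polyfunD.
  apply: (@polyfunM _ 4 (n * 2)); last first.
    apply: polyfun_prod => i.
    apply: polyfun_eq (polyfunM (lin 1 (- (q * xi i))) (lin 1 (- (xi i)^-1))) => u.
    by rewrite !mulNr [_^-1 * u]mulrC.
  apply: polyfun_eq (polyfunM (polyfunM (sq 1 (- q)) (lin (- v) 1)) (lin 1 (- z))).
  by move=> u; ring.
apply: (@polyfunM _ 4 (n * 2)); last first.
  apply: polyfun_prod => i.
  apply: polyfun_eq (polyfunM (lin q (- (xi i)^-1)) (lin 1 (- xi i))) => u.
  by rewrite !mulNr [_^-1 * u]mulrC.
apply: polyfun_eq (polyfunM (polyfunM (sq q (- 1)) (lin 1 (- v))) (lin (- z) 1)).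
by move=> u; ring.
Qed.

Lemma polyfun_zfactor n (x : 'I_n -> F) : polyfun (n * 2) (fun u => zfactor u x).
Proof.
have lin := @polyfun_lin F.
apply: polyfun_prod => i.
apply: polyfun_eq (polyfunM (lin 1 (- x i)) (lin 1 (- (x i)^-1))) => u.
by rewrite !mulNr [_^-1 * u]mulrC [x i * u]mulrC.
Qed.
End SignSum.

(** These conditions keep denominators nonzero and interpolation points distinct. Those on z allow
    all powers of q, so that they survive z -> qz; [gen_xx] with i = j excludes x_i = 1 and x_i =
    -1. *)
Record generic (F : fieldType) (q : F) n (z : F) (x : 'I_n -> F) : Prop := Generic {
  gen_z0 : z != 0;
  gen_z2 : forall k, z ^+ 2 * q ^+ k != 1;
  gen_x0 : forall i, x i != 0;
  gen_xx : forall i j, x i * x j != 1;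
  gen_neq : forall i j, i != j -> x i != x j;
  gen_zx : forall k i, z * q ^+ k * x i != 1;
  gen_zVx : forall k i, z * q ^+ k != x i }.

(** * The identity for generic values, by induction on the number of variables *)

Section MainIdentity.
Variables (F : fieldType) (q : F).
Hypotheses (q0 : q != 0) (qn1 : forall k, q ^+ k.+1 != 1).
Hypothesis two_neq0 : 2 != 0 :> F.

Lemma generic_scale n z (x : 'I_n -> F) : generic q z x -> generic q (q * z) x.
Proof.
case=> z0 z2 x0 xx neq zx zVx; split => //.
- exact: mulf_neq0.
- by move=> k; apply: contraNneq (z2 k.+2) => <-; apply/eqP; rewrite !exprS; ring.
- by move=> k i; apply: contraNneq (zx k.+1 i) => <-; apply/eqP; rewrite !exprS; ring.
- by move=> k i; apply: contraNneq (zVx k.+1 i) => <-; apply/eqP; rewrite !exprS; ring.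
Qed.

Lemma generic_lift n z (x : 'I_n.+1 -> F) :
  generic q z x -> generic q z (fun i => x (lift ord0 i)).
Proof.
case=> z0 z2 x0 xx neq zx zVx; split => // i j ij; apply: neq.
by rewrite (inj_eq lift_inj).
Qed.

Lemma generic_den n z (x : 'I_n -> F) s i :
  generic q z x -> 1 - z / signed x s i != 0.
Proof.
move=> gen; have x0 := gen_x0 gen i; rewrite subr_eq0 eq_sym /signed; case: (s i).
  by rewrite invrK; have := gen_zx gen 0 i; rewrite mulr1.
have := gen_zVx gen 0 i; rewrite mulr1; apply: contraNneq => zx.
by rewrite -(mulfVK x0 z) zx mul1r.
Qed.

(** * The inductive step: interpolation in the new variable *)

Section Step.
Variables (n r : nat) (z : F) (y : 'I_n -> F).
Hypothesis gen : generic q z y.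
Let v := q ^+ r * z.

Hypothesis IH : forall r' z', generic q z' y ->
  zfactor z' y * \sum_s weight q z' (q ^+ r' * z') (signed y s) =
  \sum_(i < r'.+1) coef q z' n r' i * zfactor (z' * q ^+ i) y.

(** [zfactor z y * lhs u] and [rhs u] are the two sides for the variables u, y, multiplied by
    [u * (1 - u ^+ 2) * zfactor u y]. *)
Let lhs u := \sum_s weight q z v (signed y s) * numer q z v (signed y s) u.

Let rhs u := \sum_(i < r.+1) coef q z n.+1 r i * zfactor (z * q ^+ i) y *
  ((1 - z * q ^+ i * u) * (u - z * q ^+ i) * ((1 - u ^+ 2) * zfactor u y)).

Let diff u := zfactor z y * lhs u - rhs u.

Let s0 s i : signed y s i != 0.
Proof. by rewrite /signed; case: (s i); rewrite ?invr_eq0 (gen_x0 gen). Qed.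

Lemma diff_at0 : diff 0 = 0.
Proof.
have Z0 : zfactor 0 y = 1.
  by rewrite /zfactor big1 // => i _; rewrite !mul0r subr0 mulr1.
(* The numerator at 0 does not depend on the signs, so the hypothesis for (z, r) applies to the sum
   of weights. *)
have N0 s : numer q z v (signed y s) 0 = - (z * (q ^+ r + q ^+ n.+1)).
  rewrite /numer big1 ?mulr1; last by move=> i _; rewrite mulr0 mul0r !subr0 mulr1.
  have -> : \prod_(i < n) ((q - 0 / signed y s i) * (1 - signed y s i * 0)) = q ^+ n.
    under eq_bigr => i _ do rewrite mul0r mulr0 !subr0 mulr1.
    by rewrite prodr_const card_ord.
  by rewrite /v [q ^+ n.+1]exprS; ring.
rewrite /diff /lhs; under eq_bigr => s _ do rewrite N0.
rewrite -mulr_suml mulrA IH //.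
rewrite /rhs mulr_suml -sumrB big1 // => i _; rewrite Z0.
transitivity (z * zfactor (z * q ^+ i) y * (coef q z n.+1 r i * q ^+ i
   - (q ^+ r + q ^+ n.+1) * coef q z n r i)); first by ring.
by rewrite coefSl // subrr mulr0.
Qed.

(** Each numerator vanishes by itself: when u = 1/u its two summands are opposite. *)
Lemma diff_sqr1 u : u ^+ 2 = 1 -> diff u = 0.
Proof.
move=> u2; have uu : u * u = 1 by rewrite -expr2.
rewrite /diff /lhs /rhs !big1 ?mulr0 ?subr0 //.
  by move=> i _; rewrite u2 subrr mul0r !mulr0.
move=> s _; apply/eqP; rewrite mulf_eq0; apply/orP; right; apply/eqP.
rewrite /numer u2.
have -> : \prod_(i < n) ((1 - q * signed y s i * u) * (1 - u / signed y s i)) =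
    \prod_(i < n) ((q - u / signed y s i) * (1 - signed y s i * u)).
  apply: eq_bigr => i _; have := s0 s i; move: (signed _ _ _) => a a0.
  transitivity ((q - u / a) * (1 - a * u) + (1 - u * u) * (1 - q)); first by field.
  by rewrite uu subrr mul0r addr0.
transitivity ((1 - q) * (u * u - 1) * (v - z) *
   \prod_(i < n) ((q - u / signed y s i) * (1 - signed y s i * u))); last first.
  by rewrite uu subrr mulr0 !mul0r.
by ring.
Qed.

(** Yields the zeros at the inverses of z and of the y_k from those at z and y_k. *)
Lemma diff_inv u : u != 0 ->
  diff u^-1 = - ((u ^- 2) ^+ 2 * \prod_(i < n) u ^- 2) * diff u.
Proof.
move=> u0; rewrite /diff mulrBr; congr (_ - _).
  rewrite /lhs !mulr_sumr; apply: eq_bigr => s _.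
  rewrite numer_inv //; move: (\prod_(i < n) _) (weight _ _ _ _) => P W; ring.
rewrite /rhs mulr_sumr; apply: eq_bigr => i _.
have -> : zfactor u^-1 y = \prod_(i < n) u ^- 2 * zfactor u y.
  rewrite /zfactor -big_split; apply: eq_bigr => j _ /=.
  by have := gen_x0 gen j; move: (y j) => a *; field; apply/andP.
move: (\prod_(i < n) _) (zfactor u y) => P Z.
by field.
Qed.

(** At u = z the second summand of [numer] vanishes, and the first turns the weight for z into the
    weight for qz with the same [v]. On the right the term i = 0 vanishes, and [coefSS] matches the
    shifted indices. *)
Lemma diff_atz : diff z = 0.
Proof.
have z0 := gen_z0 gen.
have qzgt s i := generic_den s i (generic_scale gen).
have zgt s i := generic_den s i gen.
have WE s : weight q z v (signed y s) * numer q z v (signed y s) z =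
   z * (1 - q ^+ r) * (1 - q * z ^+ 2) * (1 - z ^+ 2) *
   (zfactor (q * z) y * weight q (q * z) v (signed y s)).
  have -> : numer q z v (signed y s) z = z * (1 - q ^+ r) * (1 - q * z ^+ 2) *
      (1 - z ^+ 2) * \prod_(i < n) ((1 - q * signed y s i * z) * (1 - z / signed y s i)).
    by rewrite /numer subrr mulr0 mul0r addr0 /v; ring.
  rewrite [LHS]mulrCA; congr (_ * _).
  rewrite -(zfactor_signed _ _ s) /weight [LHS]mulrAC [RHS]mulrA; congr (_ * _).
  rewrite -!big_split; apply: eq_bigr => i _ /=; rewrite /singlew.
  move: (zgt s i) (qzgt s i) (_ / _) (1 - v / _) => + + X Y.
  move: (signed y s i) => a; move: (z / a) (q * z / a) => b c b1 c1.
  by field; apply/andP.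
rewrite /diff /lhs /rhs; under eq_bigr => s _ do rewrite WE.
rewrite -!mulr_sumr.
rewrite big_ord_recl /= mulr1 subrr mulr0 !mul0r mulr0 add0r.
have [r_0 | [r' Er]] : r = 0%N \/ exists r', r = r'.+1.
  by case: (r) => [|r']; [left | right; exists r'].
  by rewrite r_0 big_ord0 expr0 subrr mulr0 !mul0r mulr0 subrr.
have -> : v = q ^+ r' * (q * z) by rewrite /v Er exprSr mulrA.
rewrite Er (IH r' (generic_scale gen)).
rewrite !mulr_sumr -sumrB big1 // => i _.
have -> : q * z * q ^+ i = z * q ^+ i.+1 by rewrite exprS; ring.
transitivity (z * zfactor z y * zfactor (z * q ^+ i.+1) y * (1 - z ^+ 2) *
   ((1 - q ^+ r'.+1) * (1 - q * z ^+ 2) * coef q (q * z) n r' i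
   - coef q z n.+1 r'.+1 i.+1 * ((1 - z ^+ 2 * q ^+ i.+1) * (1 - q ^+ i.+1)))).
  by ring.
by rewrite coefSS // ?subrr ?mulr0 //; exact: gen_z2 gen.
Qed.

Definition flips k (s : {ffun 'I_n -> bool}) : {ffun 'I_n -> bool} :=
  [ffun i => if i == k then ~~ s i else s i].

Lemma flipsK k : involutive (flips k).
Proof. by move=> s; apply/ffunP => i; rewrite !ffunE; case: eqP; rewrite ?negbK. Qed.

Lemma diff_aty k : diff (y k) = 0.
Proof.
have y0 := gen_x0 gen k; have yy := gen_xx gen k k.
rewrite /diff; have -> : rhs (y k) = 0.
  have Z0 : zfactor (y k) y = 0.
    by rewrite /zfactor (bigD1 k) //= divff // subrr !(mulr0, mul0r).
  by rewrite /rhs Z0 big1 // => i _; rewrite !mulr0.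
have -> : lhs (y k) = 0; last by rewrite mulr0 subr0.
(* Doubling the sum allows adding its reindexing by [flips k], after which it vanishes term by
   term. *)
apply: (mulfI two_neq0); rewrite mulr0 mulr_natl mulr2n {2}/lhs.
rewrite (reindex_inj (inv_inj (flipsK k))) -big_split big1 // => s _ /=.
wlog sk : s / s k = false.
  move=> H; case sk: (s k); last exact: H.
  by rewrite addrC -{3 4}(flipsK k s) H // ffunE eqxx sk.
have fE i : i != k -> signed y s i = signed y (flips k s) i.
  by move=> /negPf ik; rewrite /signed ffunE ik.
have yyi i : i != k -> 1 - y k * y i != 0.
  by move=> _; rewrite subr_eq0 eq_sym (gen_xx gen).
have ymi i : i != k -> y k - y i != 0.
  by move=> ik; rewrite subr_eq0 (gen_neq gen) // eq_sym.
apply: (@weight_numer_flip _ _ _ _ _ _ _ k) => //.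
- by rewrite subr_eq0 eq_sym expr2.
- by rewrite subr_eq0 eq_sym; have := gen_zx gen 0 k; rewrite mulr1.
- by rewrite subr_eq0 eq_sym; have := gen_zVx gen 0 k; rewrite mulr1.
- by rewrite /signed sk.
- by rewrite /signed ffunE eqxx sk.
- move=> i ik; rewrite /signed; case: (s i); last exact: yyi.
  have yi := gen_x0 gen i; have := ymi i ik; apply: contraNneq => H.
  by rewrite -[y k](mulfVK yi) -[X in _ - X]mul1r -mulrBl -opprB H oppr0 mul0r.
- move=> i ik; rewrite /signed; case: (s i); last exact: ymi.
  have yi := gen_x0 gen i; have := yyi i ik; apply: contraNneq => H.
  by rewrite -[X in X - _](mulVf yi) -mulrBl -opprB H oppr0 mul0r.
Qed.

Lemma polyfun_diff : polyfun (4 + n * 2) diff.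
Proof.
have lin := @polyfun_lin F.
apply: polyfun_eq (polyfunD (polyfunZ (zfactor z y) (polyfun_sum _))
   (polyfunZ (-1) (polyfun_sum _))) => /=.
- move=> u; rewrite /diff /lhs /rhs mulN1r; reflexivity.
- by move=> s; apply: polyfunZ; apply: polyfun_numer.
move=> i; apply: polyfunZ.
apply: polyfun_eq (polyfunM (polyfunM (polyfunM (lin 1 (- (z * q ^+ i)))
   (lin (- (z * q ^+ i)) 1)) (polyfunM (lin 1 1) (lin 1 (-1)))) (polyfun_zfactor y)).
by move=> u; ring.
Qed.

Lemma diff_eq0 u : diff u = 0.
Proof.
have z0 := gen_z0 gen.
pose ys := [seq y i | i <- enum 'I_n].
(* With [n] counting the variables [y], these are 2n + 5 points against degree at most 2n + 4. *)
pose rs := [:: 0; 1; -1; z; z^-1] ++ ys ++ [seq a^-1 | a <- ys].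
have neq_pm1 (a : F) : a ^+ 2 != 1 -> (a != 1) /\ (a != -1).
  by move=> a2; split; apply: contraNneq a2 => ->; rewrite ?sqrrN expr1n.
have z2 : z ^+ 2 != 1 by have := gen_z2 gen 0; rewrite mulr1.
have ur : uniq rs.
  pose l := [:: 0; 1; -1; z; z^-1].
  (* The five special points are closed under inversion (0 being its own inverse), so avoiding them
     passes from y_i to its inverse. *)
  have lV a : (a^-1 \in l) = (a \in l).
    rewrite !inE !(inv_eq (@invrK F)) invr0 invr1 invrN1 invrK.
    by rewrite [(a == z^-1) || _]orbC.
  have yl i : y i \notin l.
    have y2 : y i ^+ 2 != 1 by rewrite expr2 (gen_xx gen).
    case: (neq_pm1 _ y2) => /negPf y_1 /negPf y_m1.
    rewrite !inE (negPf (gen_x0 gen i)) y_1 y_m1 /=.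
    have := gen_zVx gen 0 i; rewrite mulr1 eq_sym => /negPf ->.
    have := gen_zx gen 0 i; rewrite mulr1; apply: contraNneq => ->.
    by rewrite mulfV.
  have yinj : injective y.
    by move=> i j; apply: contra_eq => /(gen_neq gen).
  have yy i j : y i != (y j)^-1.
    apply: contraNneq (gen_xx gen i j) => ->; by rewrite mulVf // (gen_x0 gen).
  case: (neq_pm1 _ z2) => z_1 z_m1.
  rewrite cat_uniq cat_uniq !map_inj_uniq //; last exact: invr_inj.
  rewrite -enumT enum_uniq andbT; apply/and4P; split => //.
  - have zz : z != z^-1.
      by apply: contraNneq z2 => zz; rewrite expr2 {1}zz mulVf.
    have one_m1 : -1 != 1 :> F by rewrite eq_sym -subr_eq0 opprK.
    rewrite /= !inE !negb_or ![-1 == _]eq_sym ![0 == _]eq_sym ![1 == _]eq_sym.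
    rewrite oppr_eq0 oner_eq0 invr_eq0 invr_eq1 (inv_eq (@invrK F)) invrN1.
    by rewrite z0 one_m1 z_1 z_m1 zz eq_sym oner_eq0.
  - apply/hasPn => a; rewrite mem_cat => /orP[/mapP[i _ ->]|/mapP[b /mapP[i _ ->] ->]] /=.
      exact: yl.
    by rewrite lV yl.
  - apply/hasPn => a /mapP[b /mapP[i _ ->] ->] /=.
    by apply/mapP => -[j _ /eqP]; rewrite eq_sym (negPf (yy _ _)).
apply: (@polyfun_eq0 _ _ _ rs polyfun_diff) => //.
- by rewrite /rs /ys !size_cat !size_map -enumT size_enum_ord /=; lia.
have inv0 a : a != 0 -> diff a = 0 -> diff a^-1 = 0.
  by move=> a0 Da; rewrite diff_inv // Da mulr0.
have ysP a : a \in ys -> a != 0 /\ diff a = 0.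
  by case/mapP => i _ ->; split; [exact: gen_x0 gen i | exact: diff_aty].
move=> a; rewrite !mem_cat !inE -!orbA => /or4P[/eqP->|/eqP->|/eqP->|].
- exact: diff_at0.
- by apply: diff_sqr1; rewrite expr1n.
- by apply: diff_sqr1; rewrite sqrrN expr1n.
case/or4P => [/eqP->|/eqP->|/ysP[]//|/mapP[b /ysP[b0 Db] ->]].
- exact: diff_atz.
- by apply: inv0 => //; exact: diff_atz.
exact: inv0.
Qed.

Lemma cleared_identity u :
  zfactor z y *
    \sum_s weight q z (q ^+ r * z) (signed y s)
            * numer q z (q ^+ r * z) (signed y s) u =
  \sum_(i < r.+1) coef q z n.+1 r i * zfactor (z * q ^+ i) y *
    ((1 - z * q ^+ i * u) * (u - z * q ^+ i) * ((1 - u ^+ 2) * zfactor u y)).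
Proof. exact/subr0_eq/diff_eq0. Qed.

End Step.

Lemma zfactor_sum_weight n r z (x : 'I_n -> F) : generic q z x ->
  zfactor z x * \sum_s weight q z (q ^+ r * z) (signed x s) =
  \sum_(i < r.+1) coef q z n r i * zfactor (z * q ^+ i) x.
Proof.
elim: n r z x => [|n IHn] r z x gen.
  have z1 a : zfactor a x = 1 by rewrite /zfactor big_ord0.
  under [RHS]eq_bigr => i _ do rewrite z1 mulr1.
  rewrite sum_coef0 //; last exact: gen_z2 gen.
  rewrite z1 mul1r (eq_bigr (fun _ => 1)) => [|s _].
    by rewrite sumr_const card_ffun card_ord expn0.
  by rewrite /weight !big_ord0 mulr1.
pose y i := x (lift ord0 i); pose u := x ord0.
have genY : generic q z y := generic_lift gen.
have xE i : x i = consfun u y i.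
  by rewrite /consfun; case: unliftP => [j|] ->.
have zE a : zfactor a x = (1 - a * u) * (1 - a / u) * zfactor a y.
  by rewrite -zfactor_cons; apply: eq_bigr => i _; rewrite xE.
have u0 : u != 0 := gen_x0 gen ord0.
have u2 : 1 - u ^+ 2 != 0 by rewrite subr_eq0 eq_sym expr2 (gen_xx gen).
have zu : 1 - z * u != 0.
  by rewrite subr_eq0 eq_sym; have := gen_zx gen 0 ord0; rewrite mulr1.
have uz : u - z != 0.
  by rewrite subr_eq0 eq_sym; have := gen_zVx gen 0 ord0; rewrite mulr1.
have uy s i : 1 - u * signed y s i != 0 /\ u - signed y s i != 0.
  have y0 := gen_x0 genY i.
  have uy1 : 1 - u * y i != 0 by rewrite subr_eq0 eq_sym (gen_xx gen).
  have uy2 : u - y i != 0 by rewrite subr_eq0 (gen_neq gen).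
  rewrite /signed; case: (s i) => //; split.
    have -> : 1 - u / y i = - (u - y i) / y i by field.
    by rewrite mulf_neq0 ?oppr_eq0 ?invr_eq0.
  have -> : u - (y i)^-1 = - (1 - u * y i) / y i by field.
  by rewrite mulf_neq0 ?oppr_eq0 ?invr_eq0.
have y0 s i : signed y s i != 0.
  by rewrite /signed; case: (s i); rewrite ?invr_eq0 (gen_x0 genY).
have Z0 : zfactor u y != 0.
  apply/prodf_neq0 => i _; have [uy1 uy2] := uy [ffun=> false] i.
  rewrite /signed ffunE in uy1 uy2; rewrite mulf_neq0 //.
  have -> : 1 - u / y i = - (u - y i) / y i by field; exact: gen_x0 genY i.
  by rewrite mulf_neq0 ?oppr_eq0 ?invr_eq0 // (gen_x0 genY).
(* Genericity makes the clearing factor nonzero at u = x_1, so the identity may be proved after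
   multiplication by it. *)
apply: (@mulfI _ (u * (1 - u ^+ 2) * zfactor u y)); first by rewrite !mulf_neq0.
transitivity (zfactor z y * \sum_s weight q z (q ^+ r * z) (signed y s)
            * numer q z (q ^+ r * z) (signed y s) u).
  rewrite sum_ffun_bool_recl zE !mulr_sumr; apply: eq_bigr => s _.
  rewrite -weight_numer //; try by move=> i; have [] := uy s i.
  rewrite zfactor_signed.
  have E b : weight q z (q ^+ r * z)
      (signed x [ffun i => oapp s b (unlift ord0 i)]) =
      weight q z (q ^+ r * z) (consfun (if b then u^-1 else u) (signed y s)).
    apply: eq_weight => i; rewrite /signed ffunE xE /consfun.
    by case: (unlift ord0 i).
  by rewrite !E; ring.
rewrite (cleared_identity r genY (fun r' z' => IHn r' z' y)) mulr_sumr.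
by apply: eq_bigr => i _; rewrite zE; field.
Qed.

End MainIdentity.

(** * Translation into the basic hypergeometric series *)

Section Specialization.
Variable F : fieldType.
Implicit Types q z a : F.

Lemma big_pairs n (f g : 'I_n -> F) (h : F -> F) :
  \prod_(c <- pairs f g) h c = \prod_(i < n) (h (f i) * h (g i)).
Proof.
rewrite /pairs /= big_flatten big_map big_enum /=.
by apply: eq_bigr => i _; rewrite !big_cons big_nil mulr1.
Qed.

Lemma qpoch_qratio q a i :
  (forall k, a * q ^+ k != 1) ->
  qpoch (q * a) q i = qpoch a q i * ((1 - a * q ^+ i) / (1 - a)).
Proof.
move=> aq; have a1 : 1 - a != 0.
  by have := aq 0; rewrite mulr1 subr_eq0 eq_sym.
by rewrite mulrA -qpochS qpochSl [(1 - a) * _]mulrC mulfK // mulrC.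
Qed.

(** Every parameter qa above is matched by a below, and by [qpoch_qratio] such a pair leaves only (1
    - a q^i)/(1 - a). The pairs with x_j give the quotient of the [zfactor] terms. *)
Lemma prefactor_qhyper_term q z n r i (x : 'I_n -> F) : generic q z x ->
  prefactor q z n r *
  @qhyper_term F (3 + 2 * n)
    [tuple of [:: z ^+ 2; q * z; - (q * z); q ^- r]
              ++ pairs (fun i => q * z * x i) (fun i => q * z / x i)]
    [tuple of [:: z; - z; q ^+ r.+1 * z ^+ 2]
              ++ pairs (fun i => z * x i) (fun i => z / x i)]
    q (- q ^ (r%:Z - n%:Z)) i
  = coef q z n r i * zfactor (z * q ^+ i) x / zfactor z x.
Proof.
move=> gen.
(* Both follow from [gen_z2] at exponent 2k, as z^2 q^(2k) is the square of z q^k. *)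
have zq k : (z * q ^+ k != 1) && (- z * q ^+ k != 1).
  have := gen_z2 gen (k * 2); rewrite exprM -exprMn => zk.
  apply/andP; split; apply: contraNneq zk => zk; first by rewrite zk expr1n.
  by rewrite -sqrrN -mulNr zk expr1n.
have zq1 k : z * q ^+ k != 1 by case/andP: (zq k).
have zq2 k : - z * q ^+ k != 1 by case/andP: (zq k).
have zx k j : z * x j * q ^+ k != 1 by rewrite mulrAC (gen_zx gen).
have zVx k j : z / x j * q ^+ k != 1.
  apply: contraNneq (gen_zVx gen k j) => H.
  by rewrite -[z](mulfVK (gen_x0 gen j)) mulrAC H mul1r.
rewrite /qhyper_term /= !big_cons !big_pairs.
have -> : \prod_(j < n) (qpoch (q * z * x j) q i * qpoch (q * z / x j) q i) =
   \prod_(j < n) (qpoch (z * x j) q i * qpoch (z / x j) q i) *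
   (zfactor (z * q ^+ i) x / zfactor z x).
  rewrite -prodfV -!big_split; apply: eq_bigr => j _ /=.
  rewrite -!mulrA !qpoch_qratio //.
  have -> : z * x j * q ^+ i = z * (q ^+ i * x j) by ring.
  have -> : z / x j * q ^+ i = z * (q ^+ i / x j) by rewrite mulrAC mulrA.
  rewrite invfM; move: (1 - z * x j)^-1 (1 - z / x j)^-1 => X Y; ring.
rewrite -mulrN !qpoch_qratio // /coef.
have nz1 : qpoch z q i != 0 by apply: qpoch_neq0.
have nz2 : qpoch (- z) q i != 0 by apply: qpoch_neq0.
have nz3 : \prod_(j < n) (qpoch (z * x j) q i * qpoch (z / x j) q i) != 0.
  by apply/prodf_neq0 => j _; rewrite mulf_neq0 //; apply: qpoch_neq0.
have nz4 : 1 - z != 0 by have := zq1 0; rewrite mulr1 subr_eq0 eq_sym.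
have nz5 : 1 - - z != 0 by have := zq2 0; rewrite mulr1 subr_eq0 eq_sym.
have -> : (1 - z ^+ 2 * q ^+ i ^+ 2) / (1 - z ^+ 2) =
    (1 - z * q ^+ i) / (1 - z) * ((1 - - z * q ^+ i) / (1 - - z)).
  by rewrite mulf_div; congr (_ / _); ring.
move: nz1 nz2 nz3; move: (_ / (1 - z)) (_ / (1 - - z)) (zfactor _ _) => X Y Z.
rewrite !invfM; move: (qpoch z q i) (qpoch (- z) q i) (\prod_(j < n) _) => P Q S.
move: (qpoch q q i)^-1 (qpoch (_ * _) q i)^-1 (zfactor z x)^-1 => *.
by field; do ?[apply/andP; split].
Qed.

Lemma sum_weight_qhyper q z n r (x : 'I_n -> F) :
  q != 0 -> (forall k, q ^+ k.+1 != 1) -> 2 != 0 :> F -> generic q z x ->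
  \sum_s weight q z (q ^+ r * z) (signed x s) = prefactor q z n r *
  @qhyper F (3 + 2 * n)
    [tuple of [:: z ^+ 2; q * z; - (q * z); q ^- r]
              ++ pairs (fun i => q * z * x i) (fun i => q * z / x i)]
    [tuple of [:: z; - z; q ^+ r.+1 * z ^+ 2]
              ++ pairs (fun i => z * x i) (fun i => z / x i)]
    q (- q ^ (r%:Z - n%:Z)).
Proof.
move=> q0 qn1 two gen.
rewrite (@qhyper_terminates _ _ _ _ _ _ r) //; last by rewrite !inE eqxx !orbT.
have Z0 : zfactor z x != 0.
  apply/prodf_neq0 => i _; have x0 := gen_x0 gen i; apply: mulf_neq0.
    by rewrite subr_eq0 eq_sym; have := gen_zx gen 0 i; rewrite mulr1.
  by have := generic_den [ffun=> false] i gen; rewrite /signed ffunE.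
apply: (mulfI Z0); rewrite zfactor_sum_weight // !mulr_sumr.
apply: eq_bigr => i _; rewrite prefactor_qhyper_term //.
by rewrite [RHS]mulrC divfK.
Qed.

End Specialization.

(** * Genericity of the indeterminates *)

Section RationalFunctions.
Variables (K : fieldType) (n : nat).
Hypothesis charK : [pchar K] =i pred0.

(** Reduces each genericity condition to one evaluation: at the origin, at the all-ones point, or at
    the point where only x_i is 1 and the other variables are 0. *)
Lemma tofrac_neq (v : 'I_(n + 2) -> K) (f g : {mpoly K[n + 2]}) :
  f.@[v] != g.@[v] -> tofrac f != tofrac g.
Proof. by rewrite tofrac_eq; apply: contraNneq => ->. Qed.

Lemma generic_vars : generic (qvar K n) (zvar K n) (@xvar K n).
Proof.
pose at0 (_ : 'I_(n + 2)) : K := 0; pose at1 (_ : 'I_(n + 2)) : K := 1.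
have inj_x (i j : 'I_n) : (lshift 2 i == lshift 2 j) = (i == j).
  by rewrite (inj_eq (@lshift_inj _ _)).
split=> [|k|i|i j|i j ij|k i|k i]; rewrite /xvar /zvar /qvar;
  rewrite -?(tofrac0, tofrac1, tofracXn, tofracM).
- by apply: (@tofrac_neq at1); rewrite mevalXU meval0 oner_eq0.
- apply: (@tofrac_neq at0).
  by rewrite meval1 mevalM rmorphXn /= mevalXU expr2 !mul0r eq_sym oner_eq0.
- by apply: (@tofrac_neq at1); rewrite mevalXU meval0 oner_eq0.
- apply: (@tofrac_neq at0).
  by rewrite meval1 mevalM mevalXU !mul0r eq_sym oner_eq0.
- apply: (@tofrac_neq (fun k => (k == lshift 2 i)%:R)).
  by rewrite !mevalXU eqxx inj_x [j == i]eq_sym (negPf ij) oner_eq0.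
- apply: (@tofrac_neq at0).
  by rewrite meval1 !mevalM mevalXU !mul0r eq_sym oner_eq0.
- apply: (@tofrac_neq (fun k => (k == lshift 2 i)%:R)).
  by rewrite mevalM !mevalXU eqxx eq_rlshift mul0r eq_sym oner_eq0.
Qed.

Lemma qvar_neq0 : qvar K n != 0.
Proof.
rewrite -tofrac0; apply: (@tofrac_neq (fun _ => 1)).
by rewrite mevalXU meval0 oner_eq0.
Qed.

Lemma qvarX_neq1 k : qvar K n ^+ k.+1 != 1.
Proof.
rewrite -tofrac1 -tofracXn; apply: (@tofrac_neq (fun _ => 0)).
by rewrite meval1 rmorphXn /= mevalXU exprS mul0r eq_sym oner_eq0.
Qed.

Lemma ratfun_two_neq0 : 2 != 0 :> ratfun K n.
Proof.
rewrite -tofrac0 -[2](rmorph_nat (@tofrac {mpoly K[n + 2]})).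
apply: (@tofrac_neq (fun _ => 0)); rewrite rmorph_nat meval0.
by have := charK 2; rewrite !inE /= => ->.
Qed.

End RationalFunctions.

Theorem theorem8 (K : fieldType) (charK : [pchar K] =i pred0)
    (n r : nat) (n_ge1 : (1 <= n)%N) :
  let x : 'I_n -> ratfun K n := @xvar K n in
  let z : ratfun K n := zvar K n in
  let q : ratfun K n := qvar K n in
  \sum_(s : {ffun 'I_n -> bool})
     ((\prod_(i < n)
         ((1 - q * x i ^ (2 * sgn_of s i)) / (1 - x i ^ (2 * sgn_of s i))
          * ((1 - q ^+ r * z * x i ^ (- sgn_of s i))
             / (1 - z * x i ^ (- sgn_of s i)))))
      * \prod_(i < n) \prod_(j < n | (i < j)%N)
          ((1 - q * x i ^ sgn_of s i * x j ^ sgn_of s j)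
           / (1 - x i ^ sgn_of s i * x j ^ sgn_of s j)))
  = q ^ ((n * r)%:Z - 'C(r, 2)%:Z)
    * qpochN q (n%:Z - r%:Z)
    * (qpoch (q * z ^+ 2) (q ^+ 2) r / qpoch (q * z ^+ 2) q r)
    * @qhyper (ratfun K n) (3 + 2 * n)
        [tuple of [:: z ^+ 2; q * z; - (q * z); q ^- r]
                  ++ pairs (fun i => q * z * x i) (fun i => q * z / x i)]
        [tuple of [:: z; - z; q ^+ r.+1 * z ^+ 2]
                  ++ pairs (fun i => z * x i) (fun i => z / x i)]
        q (- q ^ (r%:Z - n%:Z)).
Proof.
move=> x z q; rewrite -[RHS]sum_weight_qhyper.
- apply: eq_bigr => s _.
  have xs i : x i ^ sgn_of s i = signed x s i.
    by rewrite /sgn_of /signed; case: (s i).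
  have xVs i : x i ^ (- sgn_of s i) = (signed x s i)^-1 by rewrite -invr_expz xs.
  have x2s i : x i ^ (2 * sgn_of s i) = signed x s i ^+ 2.
    by rewrite mulrC -exprz_exp xs.
  congr (_ * _); first by apply: eq_bigr => i _; rewrite x2s xVs.
  by apply: eq_bigr => i _; apply: eq_bigr => j _; rewrite !xs.
- exact: qvar_neq0.
- exact: qvarX_neq1.
- exact: ratfun_two_neq0.
- exact: generic_vars.
Qed.
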